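(* Let $N = q^k n^2$ be an odd perfect number given in Eulerian form, and suppose the smallest prime factor $u$ of $N$ satisfies $u \geq 5$. Then $q < n$.
   Context: For a positive integer $x$, $\sigma(x)$ denotes the sum of the positive divisors of $x$. A positive integer $N$ is perfect if $\sigma(N) = 2N$. An odd perfect number $N$ is said to be given in Eulerian form if $N = q^k n^2$ where $q$ is a prime, $q \equiv k \equiv 1 \pmod 4$, $n$ is a positive integer, and $\gcd(q,n) = 1$. *)

(* Defs.v *)
From mathcomp Require Import all_boot.
Set Implicit Arguments. Unset Strict Implicit. Unset Printing Implicit Defensive.

Definition sigma (x : nat) : nat := \sum_(d <- divisors x) d.

Definition perfect (N : nat) : Prop := 0 < N /\ sigma N = 2 * N.

Definition eulerian_form (N q k n : nat) : Prop :=
  N = q ^ k * n ^ 2 /\ prime q /\ q %% 4 = 1 /\ k %% 4 = 1 /\ 0 < n /\ coprime q n.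

(* Main.v *)
Require Import Defs.
From mathcomp Require Import all_boot.
From mathcomp Require Import zify.

Set Implicit Arguments.
Unset Strict Implicit.
Unset Printing Implicit Defensive.

(** The case k > 1 is easy: sigma (q^k) divides 2 n^2, so q^3 <= q^k < 2 n^2.

For k = 1, following Acquaah and Konyagin, choose a prime p with p^a || n and
q | sigma (p^(2a)) = q c, write n = p^a m, and suppose n <= q. Comparing sizes
in (q + 1) c sigma (m^2) = 2 p^(2a) m^2 leaves only the case q = sigma (p^(2a)),
sigma (m^2) = p^(2a), 2 m^2 = q + 1.

To exclude it, note that for r | m the repunit of base r and odd length
L r = 2 v_r(m) + 1 is a power p^t of p, hence r^(L r) = 1 + (r - 1) p^t.
Raising m^2 = prod r^(L r - 1) to the power Lam = prod (L r), prime to p, and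
comparing with 2 m^2 = 2 + p modulo p^2 shows that the sum over those r with
t = 1 satisfies 2 sum (r - 1) (L r - 1) Lam / L r = Lam modulo p.
After cancelling the L r with t > 1, the remaining lengths are distinct primes
which divide p - 1, and so do their bases r. Let Y be the largest length. Since
2 Lam times the product of the bases larger than Y divides p - 1, while
Lam <= 4^Y / 3600 (for Y > 10) and p > 5^(Y - 1), the left-hand side lies strictly
between Lam and p, a contradiction. *)

(** * Divisor sums and prime factorizations *)

Lemma sigma_primeX p e : prime p -> sigma (p ^ e) = \sum_(i < e.+1) p ^ i.
Proof.
move=> p_pr; rewrite /sigma -(big_mkord predT (fun i => p ^ i)) /index_iota subn0.
rewrite -(big_map (fun i => p ^ i) predT id); apply: perm_big.
apply: uniq_perm; first exact: divisors_uniq.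
  rewrite map_inj_uniq ?iota_uniq //; exact: expnI (prime_gt1 p_pr).
move=> d; rewrite -dvdn_divisors ?expn_gt0 ?prime_gt0 //.
apply/dvdn_pfactor/mapP => // -[i]; rewrite ?mem_iota => le_ie ->; exists i => //.
by rewrite mem_iota.
Qed.

Lemma dvdn_mul_gcd d m n : d %| m * n -> coprime m n ->
  d = gcdn d m * gcdn d n.
Proof.
move=> d_mn co_mn; apply/eqP; rewrite eqn_dvd; apply/andP; split.
  rewrite muln_gcdr dvdn_gcd dvdn_mull //= muln_gcdl dvdn_gcd dvdn_mulr //.
rewrite Gauss_dvd ?dvdn_gcdl //.
apply: coprime_dvdl (dvdn_gcdr _ _) _; exact: coprime_dvdr (dvdn_gcdr _ _) _.
Qed.

(** Multiplying a divisor of [m] by one of [n] is a bijection onto the divisors of [m * n]; taking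
    gcds with [m] and [n] inverts it. *)
Lemma sigmaM m n : 0 < m -> 0 < n -> coprime m n ->
  sigma (m * n) = sigma m * sigma n.
Proof.
move=> m_gt0 n_gt0 co_mn.
transitivity (\sum_(d <- [seq a * b | a <- divisors m, b <- divisors n]) d);
  last by rewrite big_allpairs_dep /sigma big_distrlr.
apply: perm_big; apply: uniq_perm; first exact: divisors_uniq.
  apply: allpairs_uniq; rewrite ?divisors_uniq // => -[a b] [c d].
  have gcdE x y : x %| m -> y %| n -> gcdn (x * y) m = x.
    move=> x_m y_n; have co_my := coprime_dvdr y_n co_mn.
    by rewrite gcdnC (Gauss_gcdl _ co_my) gcdnC; apply/gcdn_idPl.
  have gcdE' x y : x %| m -> y %| n -> gcdn (x * y) n = y.
    move=> x_m y_n; have co_nx : coprime n x by rewrite coprime_sym (coprime_dvdl x_m).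
    by rewrite gcdnC (Gauss_gcdr _ co_nx) gcdnC; apply/gcdn_idPl.
  move=> /allpairsP[[? ?] /= []]; rewrite -!dvdn_divisors // => am bn [-> ->].
  move=> /allpairsP[[? ?] /= []]; rewrite -!dvdn_divisors // => cm dn [-> ->] E.
  by congr pair; [rewrite -(gcdE _ _ am bn) E gcdE | rewrite -(gcdE' _ _ am bn) E gcdE'].
move=> d; rewrite -dvdn_divisors ?muln_gt0 ?m_gt0 //.
apply/idP/allpairsP => [d_mn|[[a b] /= []]].
  exists (gcdn d m, gcdn d n); rewrite /= -!dvdn_divisors // !dvdn_gcdr.
  by split=> //; exact: dvdn_mul_gcd.
by rewrite -!dvdn_divisors // => ? ? ->; exact: dvdn_mul.
Qed.

Lemma sigma_prod_primeX (s : seq nat) (f : nat -> nat) :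
  uniq s -> {in s, forall p, prime p} ->
  sigma (\prod_(p <- s) p ^ f p) = \prod_(p <- s) sigma (p ^ f p).
Proof.
elim: s => [|p s IHs] /=; first by rewrite !big_nil /sigma big_seq1.
case/andP=> p_s s_uniq s_pr; rewrite !big_cons.
have s_pr' : {in s, forall r, prime r} by move=> r r_s; apply: s_pr; rewrite inE r_s orbT.
have p_pr : prime p by apply: s_pr; rewrite inE eqxx.
have prod_gt0 : 0 < \prod_(r <- s) r ^ f r.
  rewrite big_seq; apply: prodn_cond_gt0 => r /s_pr'/prime_gt0 r_gt0.
  by rewrite expn_gt0 r_gt0.
rewrite sigmaM ?IHs ?expn_gt0 ?(prime_gt0 p_pr) //.
apply: coprimeXl; rewrite big_seq; apply: (big_ind (coprime p)).
- exact: coprimen1.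
- by move=> x y px py; rewrite coprimeMr px.
move=> r r_s; apply: coprimeXr; rewrite prime_coprime // dvdn_prime2 // ?s_pr' //.
by apply: contraNneq p_s => ->.
Qed.

Lemma prod_primesX n : 0 < n -> n = \prod_(p <- primes n) p ^ logn p n.
Proof. by move=> /prod_prime_decomp{1}->; rewrite prime_decompE big_map. Qed.

Lemma prod_primes_dvd (s : seq nat) n :
  uniq s -> {in s, forall p, prime p /\ p %| n} -> \prod_(p <- s) p %| n.
Proof.
elim: s => [|p s IHs] /=; first by rewrite big_nil dvd1n.
case/andP=> p_s s_uniq s_pr; rewrite big_cons.
have [p_pr p_n] : prime p /\ p %| n by apply: s_pr; rewrite inE eqxx.
have s_pr' : {in s, forall r, prime r /\ r %| n}.
  by move=> r r_s; apply: s_pr; rewrite inE r_s orbT.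
rewrite Gauss_dvd ?p_n ?IHs // big_seq; apply: (big_ind (coprime p)).
- exact: coprimen1.
- by move=> x y px py; rewrite coprimeMr px.
move=> r r_s; have [r_pr _] := s_pr' r r_s.
by rewrite prime_coprime // dvdn_prime2 //; apply: contraNneq p_s => ->.
Qed.

(** * Bounds on primorials *)

Lemma prime_dvd_fact p n : prime p -> p %| n`! -> p <= n.
Proof.
move=> p_pr; elim: n => [|n IHn]; first by rewrite fact0 Euclid_dvd1.
by rewrite factS Euclid_dvdM // => /orP[/dvdn_leq->//|/IHn/leqW].
Qed.

Lemma bin_odd_half k : 'C(k.*2.+1, k) <= 4 ^ k.
Proof.
have lt_k : k < k.*2.+1 by lia.
have : \sum_(i < k.*2.+2) 'C(k.*2.+1, i) = 2 ^ k.*2.+1.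
  rewrite -[X in _ = X ^ _]/(1 + 1) expnDn; apply: eq_bigr => i _.
  by rewrite !exp1n !muln1.
have lt1 : k < k.*2.+2 by lia.
have lt2 : k.+1 < k.*2.+2 by lia.
rewrite (bigD1 (Ordinal lt1)) //= (bigD1 (Ordinal lt2)) /=; last first.
  by rewrite -val_eqE /=; lia.
have -> : 'C(k.*2.+1, k.+1) = 'C(k.*2.+1, k).
  by rewrite -bin_sub; [congr 'C(_, _); lia | lia].
have -> : 2 ^ k.*2.+1 = 2 * 4 ^ k by rewrite expnS -mul2n expnM.
lia.
Qed.

Definition primorial n := \prod_(0 <= i < n.+1 | prime i) i.

Lemma primorial_prime n : prime n.+1 -> primorial n.+1 = n.+1 * primorial n.
Proof.
move=> n_pr; rewrite /primorial big_mkcond big_nat_recr //= n_pr.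
by rewrite -big_mkcond mulnC.
Qed.

Lemma primorial_notprime n : ~~ prime n.+1 -> primorial n.+1 = primorial n.
Proof.
move=> /negbTE n_np; rewrite /primorial big_mkcond big_nat_recr //= n_np muln1.
by rewrite -big_mkcond.
Qed.

(** A prime [p] with [k + 1 < p <= 2k + 1] divides [(2k + 1)!] but neither [k!] nor [(k + 1)!], so
    it divides the binomial coefficient. *)
Lemma primorial_odd k : primorial k.*2.+1 <= primorial k.+1 * 'C(k.*2.+1, k).
Proof.
rewrite /primorial (@big_cat_nat _ _ _ k.+2) //=; last by lia.
rewrite leq_mul2l; apply/orP; right.
apply: dvdn_leq; first by rewrite bin_gt0; lia.
rewrite -big_filter; apply: prod_primes_dvd.
  by rewrite filter_uniq ?iota_uniq.
move=> p; rewrite mem_filter mem_index_iota => /and3P[p_pr lt_kp lt_p]; split=> //.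
have le_k : k <= k.*2.+1 by lia.
have p_fact j : j < p -> p %| j`! = false.
  move=> lt_jp; apply/negP => /(prime_dvd_fact p_pr); lia.
have : p %| (k.*2.+1)`! by apply: dvdn_fact; rewrite prime_gt0 //=; lia.
rewrite -(bin_fact le_k) !Euclid_dvdM // (p_fact k); last by lia.
by rewrite p_fact ?orbF //; lia.
Qed.

(* 1800 is just below [4 ^ 11 / 2310]; for [11 <= n < 22] the bound is checked by hand. *)
Lemma primorial_upper n : 10 < n -> 1800 * primorial n <= 4 ^ n.
Proof.
have P10 : primorial 10 = 210 by rewrite /primorial unlock.
have P11 := @primorial_prime 10 isT.
have P12 := @primorial_notprime 11 isT.
have P13 := @primorial_prime 12 isT.
have P14 := @primorial_notprime 13 isT.
have P15 := @primorial_notprime 14 isT.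
have P16 := @primorial_notprime 15 isT.
have P17 := @primorial_prime 16 isT.
have P18 := @primorial_notprime 17 isT.
have P19 := @primorial_prime 18 isT.
have P20 := @primorial_notprime 19 isT.
have P21 := @primorial_notprime 20 isT.
elim/ltn_ind: n => n IHn n_gt.
have [n_lt|n_ge] := ltnP n 22.
  have : n \in [:: 11; 12; 13; 14; 15; 16; 17; 18; 19; 20; 21].
    by rewrite !inE; lia.
  rewrite !inE.
  by do 10?[case/orP=> [/eqP->|]; first by lia]; move/eqP->; lia.
(* An odd [n = 2k + 1] is reduced to [k + 1] by the binomial bounds; an even [n] is not prime, so
   its primorial is that of [n - 1]. *)
have [k n_eq] : exists k, n = k.*2.+1 \/ n = k.*2.+2.
  exists n.-1./2; case: (odd n) (odd_double_half n.-1) => /=; lia.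
case: n_eq => n_eq.
  have lt_kn : k.+1 < n by lia.
  have := IHn _ lt_kn; rewrite n_eq => /(_ _)/[dup] IHk.
  have {}IHk : 1800 * primorial k.+1 <= 4 ^ k.+1 by apply: IHk; lia.
  have := leq_mul IHk (bin_odd_half k); have := primorial_odd k.
  have -> : 4 ^ k.*2.+1 = 4 ^ k.+1 * 4 ^ k by rewrite -expnD; congr (_ ^ _); lia.
  nia.
have n_np : ~~ prime k.*2.+2.
  apply/negP=> /even_prime; lia.
rewrite n_eq primorial_notprime // expnS.
have : 1800 * primorial k.*2.+1 <= 4 ^ k.*2.+1 by apply: IHn; lia.
lia.
Qed.

Lemma cube_pow4_pow5 n : 10 < n -> n ^ 3 * 4 ^ n + 1800 < 1800 * 5 ^ n.
Proof.
have base : 12 < n -> n ^ 3 * 4 ^ n <= 200 * 5 ^ n.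
  elim: n => // n IHn; rewrite ltnS leq_eqVlt => /orP[/eqP<-|n_gt]; first by lia.
  have {}IHn := IHn n_gt; rewrite 2!(expnS _ n).
  (* This inequality first holds at [n = 13], which fixes the threshold of [base]. *)
  have : 4 * n.+1 ^ 3 <= 5 * n ^ 3 by nia.
  nia.
move=> n_gt; have p5 : 4 < 5 ^ n by rewrite (leq_trans (_ : 4 < 5 ^ 1)) // leq_exp2l; lia.
have [lt_n12|] := ltnP 12 n; first by have := base lt_n12; lia.
move=> n_le; have [->|->] : n = 11 \/ n = 12 by lia.
- lia.
- lia.
Qed.

(** Shaped for [sum_weight_upper], where [2 * Lam <= primorial Y], [4 * K <= Y ^ 2 - 9] and [p] is
    at least the repunit of base 5 and length [Y]. The growth bounds settle [n > 10]; the saving of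
    9 is what makes [n = 3] and [n = 5] pass. *)
Lemma primorial_pow5 n : prime n -> odd n ->
  primorial n * (n * (n ^ 2 - 9)) + 1 < 5 ^ n.
Proof.
move=> n_pr n_odd; have [n_gt|] := ltnP 10 n.
  have := primorial_upper n_gt; have := cube_pow4_pow5 n_gt.
  have : n * (n ^ 2 - 9) <= n ^ 3 by rewrite (expnS n 2) leq_mul2l leq_subr orbT.
  nia.
have P2 : primorial 2 = 2 by rewrite /primorial unlock.
have P3 := @primorial_prime 2 isT.
have P4 := @primorial_notprime 3 isT.
have P5 := @primorial_prime 4 isT.
have P6 := @primorial_notprime 5 isT.
have P7 := @primorial_prime 6 isT.
move=> n_le; have : n \in [:: 3; 5; 7].
  move: n_pr n_odd n_le; do 11![case: n => [|n] //].
by rewrite !inE => /or3P[] /eqP->; lia.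
Qed.

(** * Repunits and multiplicative orders *)

(** For [r] prime and [L > 0] this is [sigma (r ^ (L - 1))], so divisor sums become products of
    repunits. *)
Definition repunit (r L : nat) : nat := \sum_(i < L) r ^ i.

Lemma repunitE r L : 0 < r -> r ^ L = r.-1 * repunit r L + 1.
Proof. by move=> r_gt0; rewrite -predn_exp addn1 prednK // expn_gt0 r_gt0. Qed.

Lemma repunitS r L : repunit r L.+1 = r * repunit r L + 1.
Proof.
rewrite /repunit big_ord_recl addnC; congr (_ + _).
by rewrite big_distrr; apply: eq_bigr => i _; rewrite /= expnS.
Qed.

Lemma repunitSr r L : repunit r L.+1 = repunit r L + r ^ L.
Proof. by rewrite /repunit big_ord_recr. Qed.

Lemma repunit_ltr r L L' : 0 < r -> L < L' -> repunit r L < repunit r L'.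
Proof.
move=> r_gt0; elim: L' => // L' IH; rewrite ltnS leq_eqVlt repunitSr.
have pos : 0 < r ^ L' by rewrite expn_gt0 r_gt0.
by case/orP=> [/eqP->|/IH]; lia.
Qed.

Lemma repunit_lel r s L : r <= s -> repunit r L <= repunit s L.
Proof.
move=> le_rs; apply: leq_sum => i _.
by case: (nat_of_ord i) => [|k]; rewrite ?expn0 ?leq_exp2r.
Qed.

Lemma repunit_ltl r s L : r < s -> 1 < L -> repunit r L < repunit s L.
Proof.
case: L => [|[|L]] // lt_rs _; rewrite !(repunitS _ L.+1).
have := repunit_lel L.+1 (ltnW lt_rs); have := repunitS s L; nia.
Qed.

(** Multiplication by [r - 1] turns both sides into [r ^ (d * e) - 1]. Factors of the length thus
    yield factors of the repunit. *)
Lemma repunitM r d e : 1 < r ->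
  repunit r (d * e) = repunit r d * repunit (r ^ d) e.
Proof.
move=> r_gt1; have r_gt0 := ltnW r_gt1.
have rd_gt0 : 0 < r ^ d by rewrite expn_gt0 r_gt0.
have r1_gt0 : 0 < r.-1 by lia.
apply/eqP; rewrite -(eqn_pmul2l r1_gt0) mulnA -(eqn_add2r 1) -repunitE //.
have -> : r.-1 * repunit r d = (r ^ d).-1 by rewrite (repunitE d r_gt0) addn1.
by rewrite -repunitE // expnM.
Qed.

Lemma repunit1 r : repunit r 1 = 1.
Proof. by rewrite /repunit big_ord1. Qed.

Lemma repunit_eq1 r d : 1 < r -> repunit r d = 1 -> d = 1.
Proof.
move=> r_gt1; case: d => [|[|d]] //; first by rewrite /repunit big_ord0.
by rewrite -(repunit1 r) => eq1; have := @repunit_ltr r 1 d.+2 (ltnW r_gt1) isT; lia.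
Qed.

Lemma prime_repunit r L : 1 < r -> prime (repunit r L) -> prime L.
Proof.
move=> r_gt1 rep_pr; apply/primeP; split.
  case: L rep_pr => [|[|L]] //; last by rewrite repunit1.
  by rewrite /repunit big_ord0.
move=> d /dvdnP[e def_L]; move: rep_pr; rewrite def_L mulnC repunitM //.
have [-> |d_neq1 /primeP[_ divs]] := eqVneq d 1; first by [].
have := divs _ (dvdn_mulr (repunit (r ^ d) e) (dvdnn (repunit r d))).
case/orP=> [/eqP/(repunit_eq1 r_gt1)/eqP|]; first by rewrite (negbTE d_neq1).
move=> /eqP eq_rep.
have [d0|d_gt0] := posnP d.
  by move: eq_rep; rewrite d0 /repunit !big_ord0; move: def_L; lia.
have rep_gt0 : 0 < repunit r d.
  by have := @repunit_ltr r 0 d (ltnW r_gt1) d_gt0; lia.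
have : repunit (r ^ d) e = 1 by nia.
have rd : 1 < r ^ d by rewrite -(exp1n d) ltn_exp2r.
by move=> /(repunit_eq1 rd) ->; rewrite muln1 eqxx.
Qed.

(** If [L] does not divide [p - 1], it is coprime to it, and Bezout gives [u L = v (p - 1) + 1];
    then Fermat yields [r = r ^ (u L) = 1] modulo [p]. *)
Lemma order_dvd_predn p r L : prime p -> prime L ->
  r ^ L = 1 %[mod p] -> r != 1 %[mod p] -> L %| p.-1.
Proof.
move=> p_pr L_pr rL; apply: contraNT; rewrite -prime_coprime // => co_Lp.
have fermat v : r ^ (p.-1 * v).+1 = r %[mod p].
  elim: v => [|v IHv]; first by rewrite muln0 expn1.
  rewrite mulnS -addnS expnD -modnMmr IHv modnMmr -expnSr prednK ?prime_gt0 //.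
  exact: fermat_little.
have [u v Luv _] := egcdnP p.-1 (prime_gt0 L_pr).
move: co_Lp Luv => /eqP->; rewrite addn1 (mulnC v) => Luv.
rewrite -(fermat v) -Luv mulnC expnM -modnXm rL modnXm exp1n; exact: eqxx.
Qed.

(** * Estimates for sums and products over lists *)

(** The extreme case is the list of all odd numbers from 5 to [Y], where
    [4 + 6 + ... + (Y - 1) = (Y ^ 2 - 9) / 4]. *)
Lemma sum_odd_upper (s : seq nat) Y : odd Y -> 2 < Y -> uniq s ->
  {in s, forall r, odd r /\ 5 <= r <= Y} ->
  4 * (\sum_(r <- s) r.-1) + 9 <= Y ^ 2.
Proof.
move=> Y_odd Y_gt2 s_uniq s_odd; pose t := [seq r <- index_iota 4 Y.+1 | odd r].
have : \sum_(r <- s) r.-1 <= \sum_(r <- t) r.-1.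
  apply: (uniq_sub_le_big leqnn (fun x y => leq_addr y x)) => //.
    by rewrite filter_uniq ?iota_uniq.
  by move=> r /s_odd[r_odd le_r]; rewrite mem_filter r_odd mem_index_iota; lia.
suff : 4 * (\sum_(r <- t) r.-1) + 9 = Y ^ 2 by lia.
rewrite /t big_filter; have [k ->] : exists k, Y = k.*2.+3.
  by exists (Y - 3)./2; have := odd_double_half (Y - 3); rewrite oddB //= Y_odd; lia.
elim: k => [|k IHk]; first by rewrite big_geq.
rewrite doubleS big_mkcond 2?big_nat_recr -?big_mkcond //= odd_double /=.
lia.
Qed.

Lemma argmax_seq (s : seq nat) (f : nat -> nat) : s != [::] ->
  exists2 x, x \in s & {in s, forall y, f y <= f x}.
Proof.
elim: s => // a [_ _|b s /(_ isT)[x x_s max_x] _].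
  by exists a; rewrite ?inE // => y; rewrite inE => /eqP->.
have [le_ax|/ltnW le_xa] := leqP (f a) (f x).
  exists x; first by rewrite inE x_s orbT.
  by move=> y; rewrite inE => /predU1P[->|/max_x].
exists a; first exact: mem_head.
by move=> y; rewrite inE => /predU1P[->//|/max_x/leq_trans->].
Qed.

Lemma prod_gt_sum_pred (s : seq nat) Y : {in s, forall r, Y < r} -> 0 < Y ->
  s != [::] -> Y < \prod_(r <- s) r /\ \sum_(r <- s) r.-1 < \prod_(r <- s) r.
Proof.
move=> s_gt Y_gt0; elim: s s_gt => // r [_ r_gt _|r' s IHs s_gt _].
  by rewrite !big_seq1; have := r_gt r (mem_head _ _); lia.
have: r' :: s != [::] by []; move: (r' :: s) IHs s_gt => t IHs s_gt t_n0.
rewrite !big_cons.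
have := s_gt r (mem_head _ _); case: IHs => //.
  by move=> x x_s; apply: s_gt; rewrite inE x_s orbT.
move: (\prod_(i <- _) i) (\sum_(i <- _) _) => P S gtP gtS gtr.
have : r * P = r.-1 * P.-1 + r + P.-1 by nia.
have : 0 < r.-1 * P.-1 by rewrite muln_gt0; lia.
lia.
Qed.

Lemma prime_dvd_primorial p n : prime p -> p <= n -> p %| primorial n.
Proof.
move=> p_pr le_pn; rewrite /primorial -big_filter (bigD1_seq p) ?dvdn_mulr //.
  by rewrite mem_filter p_pr mem_index_iota ltnS.
by rewrite filter_uniq ?iota_uniq.
Qed.

(** * A prime that is a repunit in several bases *)

Section RepunitPrime.

Variables (p : nat) (s : seq nat) (L : nat -> nat).
Hypotheses (p_pr : prime p) (p_odd : odd p) (s_uniq : uniq s).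
Hypothesis s_pr : {in s, forall r, prime r /\ 5 <= r}.
Hypothesis s_L : {in s, forall r, [/\ odd (L r), 1 < L r & repunit r (L r) = p]}.

Let Lam := \prod_(r <- s) L r.

Lemma length_prime r : r \in s -> prime (L r).
Proof.
move=> r_s; have [r_pr _] := s_pr r_s; have [_ _ rep] := s_L r_s.
by apply: (prime_repunit (prime_gt1 r_pr)); rewrite rep.
Qed.

(** At a fixed length greater than 1 the repunit strictly increases with the base, so its value and
    length determine the base. *)
Lemma length_inj : {in s &, injective L}.
Proof.
move=> r r' r_s r'_s eqL; have [_ L_gt1 rep] := s_L r_s; have [_ _ rep'] := s_L r'_s.
by case: (ltngtP r r') => // /repunit_ltl/(_ L_gt1); rewrite rep eqL rep' ltnn.
Qed.

Lemma base_dvd_predn r : r \in s -> r %| p.-1.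
Proof.
move=> r_s; have [_ L_gt1 <-] := s_L r_s.
by case: (L r) L_gt1 => // l _; rewrite repunitS addn1 dvdn_mulr.
Qed.

Lemma base_ltn r : r \in s -> r < p.
Proof.
by move=> /base_dvd_predn/dvdn_leq; have := prime_gt1 p_pr; lia.
Qed.

(** [r ^ L r] equals [1 + (r - 1) p] while [1 < r < p], so [r] has order [L r] modulo [p]. *)
Lemma length_dvd_predn r : r \in s -> L r %| p.-1.
Proof.
move=> r_s; have [r_pr r_ge] := s_pr r_s; have [_ _ rep] := s_L r_s.
apply: (@order_dvd_predn p r) => //; first exact: length_prime.
  by rewrite (repunitE (L r) (prime_gt0 r_pr)) rep modnMDl.
have p_gt1 := prime_gt1 p_pr; have r_lt := base_ltn r_s.
by rewrite !modn_small //; apply/eqP => r1; rewrite r1 in r_ge.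
Qed.

Lemma length_gt2 r : r \in s -> 2 < L r.
Proof. by case/s_L=> L_odd L_gt1 _; case: (L r) L_odd L_gt1 => [|[|[|l]]]. Qed.

Lemma length_dvd_prod r : r \in s -> L r %| Lam.
Proof. by move=> r_s; rewrite /Lam (bigD1_seq r) //= dvdn_mulr. Qed.

Lemma prod_length_gt0 : 0 < Lam.
Proof. by rewrite /Lam big_seq prodn_cond_gt0 // => r /length_gt2; lia. Qed.

Lemma lengths_uniq : uniq (2 :: map L s).
Proof.
rewrite /= map_inj_in_uniq ?s_uniq ?andbT; last exact: length_inj.
by apply/mapP=> -[r /length_gt2 ltL eqL]; move: ltL; rewrite -eqL.
Qed.

Lemma prod_length_primorial Y : {in s, forall r, L r <= Y} -> 1 < Y -> 2 * Lam <= primorial Y.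
Proof.
move=> leLY Y_gt1; have -> : 2 * Lam = \prod_(l <- 2 :: map L s) l.
  by rewrite big_cons big_map.
apply: dvdn_leq.
  by rewrite /primorial prodn_cond_gt0 // => i /prime_gt0.
apply: prod_primes_dvd lengths_uniq _ => l; rewrite inE => /predU1P[->|/mapP[r r_s ->]].
  by split=> //; apply: prime_dvd_primorial.
by have L_pr := length_prime r_s; split; rewrite // prime_dvd_primorial ?leLY.
Qed.

(** The prime 2, the lengths and the bases above [Y] are distinct primes dividing [p - 1]; the cut
    at [Y] keeps bases and lengths apart. *)
Lemma prod_length_bases_lt Y : {in s, forall r, L r <= Y} -> 1 < Y ->
  2 * Lam * \prod_(r <- s | Y < r) r < p.
Proof.
move=> leLY Y_gt1.
have -> : 2 * Lam * \prod_(r <- s | Y < r) r =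
    \prod_(l <- (2 :: map L s) ++ [seq r <- s | Y < r]) l.
  by rewrite big_cat big_cons big_map big_filter.
have p_gt1 := prime_gt1 p_pr.
suff /dvdn_leq : \prod_(l <- (2 :: map L s) ++ [seq r <- s | Y < r]) l %| p.-1 by lia.
apply: prod_primes_dvd.
  rewrite cat_uniq lengths_uniq filter_uniq // andbT /=.
  apply/hasPn => r; rewrite mem_filter => /andP[ltYr r_s].
  rewrite inE negb_or neq_ltn (leq_trans _ ltYr) ?orbT //=.
  by apply/mapP => -[r' /leLY leL eqr]; move: ltYr; rewrite eqr ltnNge leL.
move=> l; rewrite mem_cat inE mem_filter.
case/orP=> [/predU1P[->|/mapP[r r_s ->]]|/andP[_ l_s]].
- by split=> //; rewrite dvdn2 -subn1 oddB ?prime_gt0 // p_odd.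
- by split; [exact: length_prime | exact: length_dvd_predn].
by have [] := s_pr l_s; split=> //; exact: base_dvd_predn.
Qed.

(** Modulo [p ^ 2], [r ^ ((L r - 1) * Lam)] is [(1 + (r - 1) p) ^ ((L r - 1) * (Lam / L r))];
    [weight r] is its coefficient of [p]. *)
Let weight r := r.-1 * (L r).-1 * (Lam %/ L r).

Lemma weightE r : r \in s -> weight r * L r = r.-1 * (L r).-1 * Lam.
Proof. by move=> r_s; rewrite /weight -mulnA divnK ?length_dvd_prod. Qed.

Lemma weight_le r : r \in s -> weight r <= Lam * r.-1.
Proof.
move=> r_s; have L_gt2 := length_gt2 r_s; have L_gt0 : 0 < L r by lia.
rewrite -(leq_pmul2r L_gt0) weightE // (mulnC Lam) -!mulnA leq_mul2l.
by rewrite (mulnC Lam) leq_mul2r leq_pred !orbT.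
Qed.

Lemma weight_gt r : r \in s -> Lam < 2 * weight r.
Proof.
move=> r_s; have L_gt2 := length_gt2 r_s; have L_gt0 : 0 < L r by lia.
have [_ r_ge] := s_pr r_s; have Lam_pos := prod_length_gt0.
rewrite -(ltn_pmul2r L_gt0) -mulnA weightE //.
have : 4 * (L r).-1 <= r.-1 * (L r).-1 by rewrite leq_mul2r; lia.
by move: (r.-1 * _) => c; nia.
Qed.

(** Bases up to [Y] contribute at most [Lam * K], controlled by [rough]; those above [Y] are
    controlled by [prod_length_bases_lt]. The cases are none, one or several of the latter. *)
Lemma sum_weight_upper Y r0 : r0 \in s -> L r0 = Y -> {in s, forall r, L r <= Y} ->
  2 * \sum_(r <- s) weight r < p.
Proof.
move=> r0_s LY leLY; have Y_gt2 := length_gt2 r0_s; rewrite LY in Y_gt2.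
have Y_gt1 := ltnW Y_gt2; have Y_gt0 := ltnW Y_gt1.
have [Y_odd _ repY] := s_L r0_s; rewrite LY in Y_odd repY.
pose K := \sum_(r <- s | ~~ (Y < r)) r.-1.
have K_le : 4 * K + 9 <= Y ^ 2.
  rewrite /K -big_filter; apply: sum_odd_upper; rewrite ?filter_uniq //.
  move=> r; rewrite mem_filter -leqNgt => /andP[le_rY r_s].
  have [r_pr r_ge] := s_pr r_s; rewrite le_rY r_ge; split=> //.
  by case: (even_prime r_pr) => // r2; rewrite r2 in r_ge.
have small_le : \sum_(r <- s | ~~ (Y < r)) weight r <= Lam * K.
  rewrite /K big_distrr /= big_seq_cond [X in _ <= X]big_seq_cond.
  by apply: leq_sum => r /andP[r_s _]; apply: weight_le.
have bases_lt := prod_length_bases_lt leLY Y_gt1.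
have rough : 2 * (Lam * (Y * K)) < p.
  have : repunit 5 Y <= p.
    by rewrite -repY; apply: repunit_lel; have [] := s_pr r0_s.
  have := primorial_pow5 (length_prime r0_s); rewrite LY => /(_ Y_odd).
  have := prod_length_primorial leLY Y_gt1; have /= := @repunitE 5 Y isT.
  move: (primorial Y) (repunit 5 Y) (5 ^ Y) => P R F FE LamP lt_F le_Rp.
  have : 2 * Lam * (Y * (4 * K)) <= P * (Y * (Y ^ 2 - 9)).
    by apply: leq_mul; rewrite // leq_mul2l; lia.
  lia.
rewrite (bigID (fun r => Y < r)) /=; move: bases_lt.
rewrite -big_filter -[in X in _ -> X]big_filter.
case def_s : [seq r <- s | Y < r] => [|r1 t].
  rewrite !big_nil => _; apply: leq_ltn_trans rough.
  by rewrite add0n leq_mul2l (leq_trans small_le) // leq_mul2l leq_pmull ?orbT.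
have r1t_s : {in r1 :: t, forall r, r \in s /\ Y < r}.
  by move=> r; rewrite -def_s mem_filter => /andP[].
have [r1_s r1_gt] := r1t_s _ (mem_head _ _).
case: t => [|r2 t] in def_s r1t_s *.
  rewrite !big_seq1 => lt_p; have := weightE r1_s; have L1_gt2 := length_gt2 r1_s.
  have := leLY _ r1_s; move: (L r1) (weight r1) L1_gt2 => l v l_gt2 le_lY vE.
  have l_gt0 : 0 < l by lia.
  have vKE : (v + Lam * K) * l = Lam * (r1.-1 * l.-1 + K * l) by lia.
  (* One base above [Y]: multiplied by [l], the inequality [v + Lam * K <= Lam * r1] is exactly the
     first alternative; in the second, [r1 - 1 < l * K] and [rough] applies. *)
  have [fine|coarse] := leqP (l * K) (r1 + l.-1).
    suff : v + Lam * K <= Lam * r1 by lia.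
    rewrite -(leq_pmul2r l_gt0) vKE -mulnA leq_mul2l; apply/orP; right.
    by nia.
  suff : v + Lam * K <= Lam * (Y * K) by lia.
  rewrite -(leq_pmul2r l_gt0) vKE -mulnA leq_mul2l; apply/orP; right.
  have : r1.-1 * l.-1 <= l * K * l.-1 by rewrite leq_mul2r; lia.
  have : l * K * l <= Y * K * l by rewrite leq_mul2r leq_mul2r le_lY !orbT.
  by nia.
move=> lt_p.
have : \sum_(r <- [:: r1, r2 & t]) weight r <= Lam * \sum_(r <- [:: r1, r2 & t]) r.-1.
  rewrite big_distrr /= big_seq [X in _ <= X]big_seq.
  by apply: leq_sum => r /r1t_s[r_s _]; apply: weight_le.
have t_gt : {in r2 :: t, forall r, Y < r}.
  by move=> r r_t; have [] := r1t_s r; rewrite // inE r_t orbT.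
case: (prod_gt_sum_pred t_gt Y_gt0 isT).
move: lt_p; rewrite !(big_cons _ _ r1).
move: (\prod_(r <- r2 :: t) r) (\sum_(r <- r2 :: t) r.-1).
move: (weight r1 + _) => v P S lt_p gtP gtS le_v.
suff : v + \sum_(r <- s | ~~ (Y < r)) weight r <= Lam * (r1 * P) by lia.
suff : Lam * (r1.-1 + S) + Lam * K <= Lam * (r1 * P) by lia.
rewrite -mulnDr leq_mul2l; apply/orP; right.
(* Several bases above [Y]: [r1 * P] exceeds [r1 + P - 1] by [(r1 - 1) (P - 1)], which is at least
   [Y ^ 2] and hence more than [K]. *)
have : Y * Y <= r1.-1 * P.-1 by apply: leq_mul; lia.
by nia.
Qed.

(** For nonempty [s] both sides are already reduced, as [Lam < 2 * sum < p]; an empty [s] gives 0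
    against 1. *)
Lemma sum_weight_mod : ~~ (2 * \sum_(r <- s) weight r == Lam %[mod p]).
Proof.
have p_gt1 := prime_gt1 p_pr.
have [s0|s_n0] := eqVneq s [::].
  by rewrite /Lam s0 !big_nil muln0 mod0n modn_small.
have [r0 r0_s maxL] := argmax_seq L s_n0.
have X_lt := sum_weight_upper r0_s erefl maxL.
have Lam_lt : Lam < 2 * \sum_(r <- s) weight r.
  by have := weight_gt r0_s; rewrite (bigD1_seq r0) //=; lia.
by rewrite !modn_small ?(ltn_trans Lam_lt) //; lia.
Qed.

End RepunitPrime.

(** * Expansions modulo the square of a prime *)

Lemma eqn_mod_pmul2l c d x y : coprime c d ->
  (c * x == c * y %[mod d]) = (x == y %[mod d]).
Proof.
move=> co_cd; wlog le_yx : x y / y <= x.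
  by move=> IH; have [/IH//|/ltnW/IH] := leqP y x;
    rewrite ![_ == _ * x %[mod d]]eq_sym [RHS]eq_sym.
rewrite !eqn_mod_dvd ?leq_mul2l ?le_yx ?orbT // -mulnBr Gauss_dvdr // coprime_sym //.
Qed.

Lemma mul1Dp_mod x y p : (1 + x * p) * (1 + y * p) = 1 + (x + y) * p %[mod p ^ 2].
Proof.
have -> : (1 + x * p) * (1 + y * p) = x * y * p ^ 2 + (1 + (x + y) * p) by lia.
by rewrite modnMDl.
Qed.

Lemma exp1Dp_mod x p k : (1 + x * p) ^ k = 1 + k * x * p %[mod p ^ 2].
Proof.
elim: k => // k IHk.
by rewrite expnS -modnMmr IHk modnMmr mul1Dp_mod mulSn.
Qed.

Lemma prod1Dp_mod (s : seq nat) (F x : nat -> nat) p :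
  {in s, forall r, F r = 1 + x r * p %[mod p ^ 2]} ->
  \prod_(r <- s) F r = 1 + (\sum_(r <- s) x r) * p %[mod p ^ 2].
Proof.
elim: s => [|r s IHs] Fx; first by rewrite !big_nil.
have {}IHs := IHs (fun r r_s => Fx r (mem_behead (r_s : r \in behead (_ :: s)))).
by rewrite !big_cons -modnMm Fx ?mem_head // IHs modnMm mul1Dp_mod.
Qed.

(* If [L = l * p], the factor [repunit (r ^ l) p] is congruent to [p] modulo [p ^ 2],
   hence equal to [p], which is too small. *)
Lemma repunit_pfactor_ndvd p r L t : prime p -> odd p -> 1 < r -> 0 < L ->
  repunit r L = p ^ t -> ~~ (p %| L).
Proof.
move=> p_pr p_odd r_gt1 L_gt0 rep; apply/negP=> /dvdnP[l def_L].
have p_gt1 := prime_gt1 p_pr; have p_gt0 := ltnW p_gt1.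
have l_gt0 : 0 < l by case: l def_L L_gt0 => // ->.
pose y := r ^ l; have y_gt1 : 1 < y by rewrite -(exp1n l) ltn_exp2r.
have : repunit y p %| p ^ t by rewrite -rep def_L repunitM // dvdn_mull.
case/dvdn_pfactor=> // e _ rep_y.
have rep_gt : p < repunit y p.
  have := @repunit_ltl 1 y p y_gt1 p_gt1; rewrite {1}/repunit.
  by under eq_bigr do rewrite exp1n; rewrite sum1_card card_ord.
have e_gt1 : 1 < e.
  by move: rep_gt; rewrite rep_y -{1}(expn1 p) ltn_exp2l.
have : y = 1 %[mod p].
  rewrite -(fermat_little y p_pr) (repunitE p (ltnW y_gt1)) rep_y.
  by rewrite -(subnK (ltnW e_gt1)) expnD expn1 mulnA modnMDl.
move/eqP; rewrite eqn_mod_dvd ?(ltnW y_gt1) // => /dvdnP[k def_y].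
(* With [y = 1 + k p], the linear terms add up to [k p (0 + ... + (p - 1))], a multiple of [p ^ 2]
   because [p] is odd. *)
have : repunit y p = p %[mod p ^ 2].
  have -> : y = 1 + k * p by lia.
  rewrite /repunit -(big_mkord predT (fun i => (1 + k * p) ^ i)).
  rewrite -modn_summ; under eq_bigr do rewrite exp1Dp_mod.
  rewrite modn_summ big_split /= sum_nat_const_nat subn0 muln1.
  under eq_bigr do rewrite -mulnA; rewrite -big_distrl /=.
  have -> : \sum_(0 <= i < p) i = p * p.-1./2 by rewrite bin2_sum bin2odd.
  by rewrite addnC (_ : _ * _ = p.-1./2 * k * p ^ 2) ?modnMDl //; lia.
rewrite rep_y -(subnK e_gt1) expnD modnMl modn_small ?mul1n; first by lia.
by rewrite -{1}(expn1 p) ltn_exp2l.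
Qed.

(** A repunit of base [p] and length at least 3 is [1 + p] modulo [p ^ 2], so [2 x] is [2 + p];
    [p.+1./2] is the inverse of 2 modulo [p]. *)
Lemma sqr_mod_of_repunit p a x : odd p -> 0 < a ->
  2 * x = repunit p (2 * a).+1 + 1 -> x = 1 + p.+1./2 * p %[mod p ^ 2].
Proof.
move=> p_odd a_gt0 def_x; apply/eqP; rewrite -(@eqn_mod_pmul2l 2); last first.
  by rewrite coprimeXr // coprime2n.
case: a a_gt0 def_x => // b _ ->.
have -> : (2 * b.+1).+1 = (2 * b).+3 by lia.
rewrite 2!repunitS.
have p2 : 2 * p.+1./2 = p.+1 by lia.
have -> : 2 * (1 + p.+1./2 * p) = p ^ 2 + (2 + p) by lia.
apply/eqP; rewrite modnDl; move: (repunit _ _) => c.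
have -> : p * (p * c + 1) + 1 + 1 = c * p ^ 2 + (2 + p) by lia.
by rewrite modnMDl.
Qed.

(** * Excluding the exceptional case *)

(** The repunit stands for [q = sigma (p ^ (2 * a))]: this is the configuration that survives the
    size comparison in [special_prime_lt]. *)
Lemma sigma_sqr_neq_pfactor p a m : prime p -> odd p -> 0 < a -> 0 < m ->
  (forall r, prime r -> r %| m -> 5 <= r) ->
  sigma (m ^ 2) = p ^ (2 * a) -> 2 * m ^ 2 <> repunit p (2 * a).+1 + 1.
Proof.
move=> p_pr p_odd a_gt0 m_gt0 m_ge5 sigma_m def_m.
pose L r := (2 * logn r m).+1; pose R := primes m.
have R_pr : {in R, forall r, [/\ prime r, 5 <= r & 0 < logn r m]}.
  move=> r; rewrite mem_primes => /and3P[r_pr _ r_m]; split=> //; first exact: m_ge5.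
  by rewrite logn_gt0 mem_primes r_pr m_gt0.
have def_m2 : m ^ 2 = \prod_(r <- R) r ^ (2 * logn r m).
  rewrite {1}(prod_primesX m_gt0) -mulnn -big_split /=.
  by apply: eq_bigr => r _; rewrite -expnD addnn mul2n.
have rep_R r : r \in R -> exists2 t, 0 < t & repunit r (L r) = p ^ t.
  move=> r_R; have [r_pr _ v_gt0] := R_pr r r_R.
  have : repunit r (L r) %| p ^ (2 * a).
    rewrite -sigma_m def_m2 sigma_prod_primeX ?primes_uniq //; last first.
      by move=> r' /R_pr[].
    by rewrite (bigD1_seq r) ?primes_uniq //= sigma_primeX // dvdn_mulr.
  case/dvdn_pfactor=> // t _ rep; exists t => //; case: t rep => // rep1.
  have := repunit_eq1 (prime_gt1 r_pr) rep1; rewrite /L; lia.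
have L_ndvd r : r \in R -> ~~ (p %| L r).
  move=> r_R; have [r_pr _ _] := R_pr r r_R; have [t _ rep] := rep_R r r_R.
  exact: (repunit_pfactor_ndvd p_pr p_odd (prime_gt1 r_pr) _ rep).
pose Lam := \prod_(r <- R) L r.
have L_Lam r : r \in R -> L r %| Lam.
  by move=> r_R; rewrite /Lam (bigD1_seq r) ?primes_uniq //= dvdn_mulr.
(* [c r] is the coefficient of [p] in [r ^ (2 * logn r m * Lam)] modulo [p ^ 2]; it vanishes for
   [t > 1], where [r ^ L r] is 1 modulo [p ^ 2]. *)
pose c r := (if repunit r (L r) == p then r.-1 else 0) * (L r).-1 * (Lam %/ L r).
have main : (\sum_(r <- R) c r) * p = Lam * p.+1./2 * p %[mod p ^ 2].
  apply/eqP; rewrite -(eqn_modDl 1).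
  rewrite -exp1Dp_mod -modnXm -(sqr_mod_of_repunit p_odd a_gt0 def_m) modnXm.
  rewrite def_m2 (big_morph _ (fun x y => expnMn x y Lam) (exp1n Lam)) eq_sym.
  apply/eqP; apply: prod1Dp_mod => r r_R; rewrite -expnM.
  have [r_pr r_ge _] := R_pr r r_R; have [t t_gt0 rep] := rep_R r r_R.
  have -> : 2 * logn r m * Lam = L r * ((L r).-1 * (Lam %/ L r)).
    by rewrite mulnCA (mulnC (L r)) divnK ?L_Lam.
  rewrite expnM (repunitE _ (prime_gt0 r_pr)) addnC.
  have /(congr1 (fun x => x ^ ((L r).-1 * (Lam %/ L r)) %% p ^ 2)) : 
      (1 + r.-1 * repunit r (L r)) %% p ^ 2 =
      (1 + (if repunit r (L r) == p then r.-1 else 0) * p) %% p ^ 2.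
    case: eqP => [->//|rep_neq]; rewrite rep.
    have t_gt1 : 1 < t.
      by case: t t_gt0 rep => [|[|t]] // _ rep; case: rep_neq; rewrite rep expn1.
    by rewrite mul0n addn0 -(subnK t_gt1) expnD mulnA addnC modnMDl.
  by rewrite !modnXm => ->; rewrite exp1Dp_mod /c; congr ((1 + _) %% _); lia.
pose s := [seq r <- R | repunit r (L r) == p].
have s_uniq : uniq s by rewrite filter_uniq ?primes_uniq.
have sR r : r \in s -> r \in R by rewrite mem_filter => /andP[].
have s_pr : {in s, forall r, prime r /\ 5 <= r} by move=> r /sR/R_pr[].
have s_L : {in s, forall r, [/\ odd (L r), 1 < L r & repunit r (L r) = p]}.
  move=> r r_s; have [_ _ v_gt0] := R_pr _ (sR _ r_s); rewrite /L /=.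
  by split; [rewrite oddM | lia | move: r_s; rewrite mem_filter => /andP[/eqP]].
apply: (negP (sum_weight_mod p_pr p_odd s_uniq s_pr s_L)).
(* The lengths belonging to [t > 1] are prime to [p] and cancel, leaving the congruence that
   [sum_weight_mod] refutes. *)
pose Lam' := \prod_(r <- R | repunit r (L r) != p) L r.
have Lam_split : Lam = Lam' * \prod_(r <- s) L r.
  by rewrite /Lam (bigID (fun r => repunit r (L r) == p)) /= mulnC big_filter.
have co_Lam' : coprime Lam' p.
  rewrite coprime_sym /Lam' big_seq_cond; apply: (big_ind (coprime p)).
  - exact: coprimen1.
  - by move=> x y px py; rewrite coprimeMr px.
  by move=> r /andP[r_R _]; rewrite prime_coprime ?L_ndvd.
have sum_c : \sum_(r <- R) c r =
    Lam' * \sum_(r <- s) r.-1 * (L r).-1 * (\prod_(r <- s) L r %/ L r).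
  rewrite (bigID (fun r => repunit r (L r) == p)) /= -big_filter -/s.
  rewrite [X in _ + X]big1 ?addn0; last by move=> r /negbTE rep; rewrite /c rep.
  rewrite big_distrr /= big_seq [RHS]big_seq; apply: eq_bigr => r r_s.
  have [_ _ rep] := s_L r r_s; rewrite /c rep eqxx Lam_split.
  have Lr_dvd : L r %| \prod_(j <- s) L j by rewrite (bigD1_seq r) //= dvdn_mulr.
  by rewrite -(muln_divA _ Lr_dvd); exact: mulnCA.
rewrite -(eqn_mod_pmul2l _ _ co_Lam') -Lam_split mulnCA -sum_c.
have p_gt0 := prime_gt0 p_pr.
have : \sum_(r <- R) c r == Lam * p.+1./2 %[mod p].
  by apply/eqP; move/eqP: main; rewrite -mulnn -!muln_modl eqn_pmul2r // => /eqP.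
rewrite -(@eqn_mod_pmul2l 2) ?coprime2n // => /eqP->.
have p2 : 2 * p.+1./2 = p.+1 by lia.
by rewrite mulnCA p2 mulnS addnC modnMDl.
Qed.

(** * The case of exponent 1 *)

Lemma repunitD r d e : repunit r (d + e) = repunit r d + r ^ d * repunit r e.
Proof.
elim: d => [|d IHd]; first by rewrite /repunit big_ord0 mul1n.
by rewrite addSn !repunitS IHd expnS; lia.
Qed.

Lemma coprime_repunitS r L : coprime r (repunit r L.+1).
Proof. by rewrite repunitS -coprime_modr mulnC modnMDl coprime_modr coprimen1. Qed.

Lemma sigma_sqr_pfactor_dvd q n : prime q -> 0 < n -> q %| sigma (n ^ 2) ->
  exists2 p, prime p /\ p %| n & q %| repunit p (2 * logn p n).+1.
Proof.
move=> q_pr n_gt0; rewrite {1}(prod_primesX n_gt0) -mulnn -big_split /=.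
under eq_bigr do rewrite -expnD addnn -mul2n.
have n_pr : {in primes n, forall p, prime p} by move=> p; rewrite mem_primes => /and3P[].
rewrite sigma_prod_primeX ?primes_uniq // Euclid_dvd_prod // big_has.
case/hasP=> p p_n; rewrite sigma_primeX ?n_pr //; exists p => //.
by move: p_n; rewrite mem_primes => /and3P[].
Qed.

Lemma special_prime_lt q n : prime q -> odd q -> odd n -> coprime q n ->
  (forall r, prime r -> r %| n -> 5 <= r) ->
  q.+1 * sigma (n ^ 2) = 2 * (q * n ^ 2) -> q < n.
Proof.
move=> q_pr q_odd n_odd co_qn n_ge5 perf; rewrite ltnNge; apply/negP => le_nq.
have q_gt0 := prime_gt0 q_pr; have n_gt0 := odd_gt0 n_odd.
have q_sigma : q %| sigma (n ^ 2).
  have : q %| q.+1 * sigma (n ^ 2) by rewrite perf mulnCA dvdn_mulr.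
  by rewrite Gauss_dvdr // coprimenS.
have [p [p_pr p_n] /dvdnP[c def_c]] := sigma_sqr_pfactor_dvd q_pr n_gt0 q_sigma.
have p_ge5 := n_ge5 p p_pr p_n; have p_gt0 := prime_gt0 p_pr.
have a_gt0 : 0 < logn p n by rewrite logn_gt0 mem_primes p_pr n_gt0.
have [m co_pm def_n] := pfactor_coprime p_pr n_gt0.
move: (logn p n) def_c a_gt0 def_n => a def_c a_gt0 def_n.
have m_odd : odd m by move: n_odd; rewrite def_n oddM => /andP[].
have m_gt0 := odd_gt0 m_odd.
have p_odd : odd p by case: (even_prime p_pr) => // p2; rewrite p2 in p_ge5.
pose P := p ^ (2 * a); have P_gt0 : 0 < P by rewrite expn_gt0 p_gt0.
have def_n2 : n ^ 2 = P * m ^ 2 by rewrite def_n expnMn mulnC -expnM (mulnC a).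
have [g def_g] : exists g, q.+1 = 2 * g by exists q.+1./2; lia.
have g_gt0 : 0 < g by lia.
have eq_g : g * c * sigma (m ^ 2) = P * m ^ 2.
  have q2_gt0 : 0 < 2 * q by lia.
  have sigma_n : sigma (n ^ 2) = c * q * sigma (m ^ 2).
    rewrite def_n2 sigmaM ?expn_gt0 ?p_gt0 ?m_gt0 //; last first.
      by rewrite coprimeXl ?coprimeXr.
    by rewrite /P (sigma_primeX _ p_pr) -/(repunit _ _) def_c.
  apply/eqP; rewrite -(eqn_pmul2r q2_gt0); apply/eqP.
  by move: perf; rewrite sigma_n def_n2 def_g; clear; lia.
(* [q * c] is the repunit, which is below [P * p / (p - 1) <= 5 P / 4]. *)
have le_qc : 4 * (q * c) < 5 * P.
  have := repunitE (2 * a).+1 p_gt0; rewrite def_c expnS -/P.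
  by clear -p_ge5; nia.
have co_pc : coprime p c.
  by apply: coprime_dvdr (coprime_repunitS p (2 * a)); rewrite def_c dvdn_mulr.
have c_gt0 : 0 < c by case: c co_pc {eq_g le_qc def_c} => //; rewrite /coprime gcdn0; lia.
(* With [(q + 1) / 2 = g' p ^ e] and [g'] prime to [p], [g' * c] divides [m ^ 2], with cofactor [d].
   The exceptional case is [c = d = 1], [e = 0]. *)
have [g' co_pg' def_g'] := pfactor_coprime p_pr g_gt0.
move: (logn p g) def_g' => e def_g'.
have pe_gt0 : 0 < p ^ e by rewrite expn_gt0 p_gt0.
have g'_gt0 : 0 < g' by case: g' def_g' {co_pg'} => //; lia.
have /dvdnP[d def_d] : g' * c %| m ^ 2.
  have <- : (g' * c %| P * m ^ 2) = (g' * c %| m ^ 2).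
    by apply: Gauss_dvdr; rewrite coprime_sym coprimeXl // coprimeMr co_pg'.
  by rewrite -eq_g def_g'; apply/dvdnP; exists (p ^ e * sigma (m ^ 2)); lia.
have d_odd : odd d.
  have : odd (m ^ 2) by rewrite oddX m_odd.
  by rewrite def_d oddM => /andP[].
have eq_sigma : p ^ e * sigma (m ^ 2) = P * d.
  have gc_gt0 : 0 < g' * c by rewrite muln_gt0 g'_gt0.
  apply/eqP; rewrite -(eqn_pmul2r gc_gt0); apply/eqP.
  by rewrite -[RHS]mulnA -def_d -eq_g def_g'; lia.
(* [n <= q] gives [P * m ^ 2 <= q ^ 2]; replacing [m ^ 2] by [d g' c] and [P] by its lower bound
   [4 q c / 5] leaves this. *)
have size : 4 * (c * c * d) < 10 * p ^ e.
  have le_n2 : P * m ^ 2 <= q * q by rewrite -def_n2 -mulnn leq_mul.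
  have qq_gt0 : 0 < q * q by rewrite muln_gt0 q_gt0.
  have cd_gt0 : 0 < q.+1 * (d * c) by rewrite !muln_gt0 c_gt0 (odd_gt0 d_odd).
  have eq_m : 10 * (p ^ e * (P * m ^ 2)) = 5 * P * (q.+1 * (d * c)).
    by rewrite def_g def_g' def_d; clear; lia.
  have lt1 : 4 * (q * c) * (q.+1 * (d * c)) < 5 * P * (q.+1 * (d * c)).
    by rewrite ltn_pmul2r.
  rewrite -(ltn_pmul2r qq_gt0); apply: (@leq_ltn_trans (4 * (q * c) * (q.+1 * (d * c)))).
    have -> : 4 * (c * c * d) * (q * q) = 4 * (q * c) * (q * (d * c)) by clear; lia.
    by rewrite !leq_mul2l leq_mul2r leqnSn !orbT.
  apply: leq_trans lt1 _; rewrite -eq_m -mulnA leq_mul2l /= leq_mul2l le_n2 orbT.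
  by [].
have [e0|e_gt0] := posnP e.
  rewrite e0 expn0 mul1n in size eq_sigma.
  (* Here [c ^ 2 d < 5 / 2] with [d] odd, which forces [c = d = 1]. *)
  have c1 : c = 1 by clear -size c_gt0 d_odd; case: d d_odd size => // d _; nia.
  have d1 : d = 1 by clear -size d_odd c1; rewrite c1 in size; lia.
  rewrite e0 muln1 in def_g'; rewrite c1 d1 -def_g' in def_d.
  apply: (@sigma_sqr_neq_pfactor p a m) => //.
  - by move=> r r_pr r_m; apply: n_ge5 => //; rewrite def_n dvdn_mulr.
  - by rewrite eq_sigma d1 muln1.
  by rewrite def_c c1; move: def_d def_g; clear; lia.
have co_pd : coprime p d.
  by apply: (@coprime_dvdr _ (m ^ 2)); rewrite ?coprimeXr // def_d dvdn_mulr.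
have le_e : e <= 2 * a.
  rewrite -(dvdn_Pexp2l _ _ (prime_gt1 p_pr)) -/P.
  by rewrite -(@Gauss_dvdl _ _ d) ?coprimeXl // -eq_sigma dvdn_mulr.
(* [p ^ e] divides [c (q + 1) = c + repunit p (2a + 1)], and modulo [p ^ e] only the lowest [e]
   terms of that repunit remain. *)
have /dvdn_leq le_pe : p ^ e %| c + repunit p e.
  have -> : c + repunit p e = c * q.+1 - p ^ e * repunit p ((2 * a).+1 - e).
    have := repunitD p e ((2 * a).+1 - e); rewrite subnKC; last by lia.
    by rewrite def_c mulnS; lia.
  apply: dvdn_sub; last exact: dvdn_mulr.
  by rewrite def_g def_g' !mulnA dvdn_mull.
have {}le_pe : p ^ e <= c + repunit p e by apply: le_pe; lia.
have le_c : 3 * p ^ e <= 4 * c.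
  have := repunitE e p_gt0; clear -p_ge5 le_pe.
  have : 4 * repunit p e <= p.-1 * repunit p e by rewrite leq_mul2r; lia.
  by lia.
have le_p : 5 <= p ^ e.
  by rewrite (leq_trans p_ge5) // -{1}(expn1 p) leq_pexp2l.
have d_gt0 := odd_gt0 d_odd.
(* With [X = p ^ e]: [9 X ^ 2 <= 16 c ^ 2 d < 40 X], impossible for [X >= 5]. *)
have : c * c <= c * c * d by rewrite leq_pmulr.
have : 3 * p ^ e * (3 * p ^ e) <= 4 * c * (4 * c) by apply: leq_mul.
have : 5 * p ^ e <= p ^ e * p ^ e by rewrite leq_mul2r le_p orbT.
by clear -size pe_gt0; lia.
Qed.

(* pdiv N is the smallest prime factor of N (for N > 1). *)
Theorem theorem5 (N q k n : nat) :
  perfect N -> odd N -> eulerian_form N q k n -> 5 <= pdiv N -> q < n.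
Proof.
move=> [N_gt0 perf] N_odd [def_N [q_pr [q_mod [k_mod [n_gt0 co_qn]]]]] N_ge5.
have N_ge5' r : prime r -> r %| N -> 5 <= r.
  by move=> /prime_gt1 r_gt1 r_N; apply: leq_trans N_ge5 (pdiv_min_dvd r_gt1 r_N).
have n_odd : odd n.
  by move: N_odd; rewrite def_N oddM !oddX /= => /andP[].
have q_odd : odd q by lia.
have k_gt0 : 0 < k by case: k k_mod {def_N}.
have n_ge5 r : prime r -> r %| n -> 5 <= r.
  by move=> r_pr r_n; apply: N_ge5' => //; rewrite def_N dvdn_mull // -mulnn dvdn_mulr.
move: perf; rewrite def_N.
rewrite sigmaM ?expn_gt0 ?n_gt0 ?(prime_gt0 q_pr) ?coprimeXl ?coprimeXr //.
rewrite sigma_primeX // -/(repunit _ _) => perf.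
have [k1|k_neq1] := eqVneq k 1.
  apply: special_prime_lt => //; move: perf; rewrite k1 expn1 => <-.
  by rewrite /repunit 2!big_ord_recl big_ord0 addn0 expn0 expn1.
have k_gt2 : 2 < k by lia.
(* [sigma (q ^ k)] is prime to [q ^ k], so it divides [2 n ^ 2]; its top term then gives
   [q ^ 3 <= 2 n ^ 2], against [n <= q]. *)
have rep_dvd : repunit q k.+1 %| 2 * n ^ 2.
  rewrite -(@Gauss_dvdr _ (q ^ k)).
    by rewrite mulnCA -perf dvdn_mulr.
  by rewrite coprime_sym coprimeXl // coprime_repunitS.
have := dvdn_leq _ rep_dvd; rewrite repunitSr muln_gt0 expn_gt0 n_gt0 => /(_ isT) le_qk.
have q3 : q ^ 3 <= q ^ k by rewrite leq_pexp2l // prime_gt0.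
have q_ge5 : 4 < q by apply: N_ge5' => //; rewrite def_N dvdn_mulr // dvdn_exp.
by rewrite ltnNge; apply/negP => le_nq; nia.
Qed.
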